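(* Let $\tau\in\mathcal T$ and assume that $\tau$ is not constant. Then $L_\tau^*\ge 1$.
   Context: A differentiable function $\tau\colon(0,\infty)\to\mathbb R$ is called a quadruple transformation if there is a constant $L_\tau\in[0,\infty)$ such that for every metric space $(\mathcal Q,d)$ and all pairwise distinct points $y,z,q,p\in\mathcal Q$ with $$d(y,q)^2-d(y,p)^2-d(z,q)^2+d(z,p)^2\le 2\,d(q,p)\,d(y,z)$$ one also has $$\tau(d(y,q))-\tau(d(y,p))-\tau(d(z,q))+\tau(d(z,p))\le L_\tau\,d(q,p)\,\tau'(d(y,z)).$$ $\mathcal T$ is the set of all quadruple transformations. For $\tau\in\mathcal T$, the quadruple constant $L_\tau^*$ is the smallest constant $L_\tau\in[0,\infty)$ with this property (it exists). *)

(* Defs.v *)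
From HB Require Import structures.
From mathcomp Require Import all_boot all_order all_algebra.
From mathcomp Require Import all_classical all_reals all_analysis.
Set Implicit Arguments.
Unset Strict Implicit.
Unset Printing Implicit Defensive.
Import Order.TTheory GRing.Theory Num.Theory.
Import numFieldNormedType.Exports.
Local Open Scope classical_set_scope.
Local Open Scope ring_scope.

(* A function tau : (0, +oo) -> R is represented by a total function R -> R.
   Only its values on (0, +oo) matter below: distances between distinct points
   are positive, and a derivative at x > 0 only depends on values near x. *)

Definition quadruple_constants (R : realType) (tau : R -> R) : set R :=
  [set L | 0 <= L /\
    forall (Q : metricType R) (y z q p : Q),
      uniq [:: y; z; q; p] ->
      mdist y q ^+ 2 - mdist y p ^+ 2 - mdist z q ^+ 2 + mdist z p ^+ 2
        <= 2 * mdist q p * mdist y z ->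
      tau (mdist y q) - tau (mdist y p) - tau (mdist z q) + tau (mdist z p)
        <= L * mdist q p * (tau^`()%classic) (mdist y z)].

Definition quadruple_transformation (R : realType) (tau : R -> R) : Prop :=
  (forall x : R, 0 < x -> derivable tau x 1) /\
  quadruple_constants tau !=set0.

(* The infimum is attained, see quadruple_constant_smallest. *)
Definition quadruple_constant (R : realType) (tau : R -> R) : R :=
  inf (quadruple_constants tau).

Lemma quadruple_constant_smallest (R : realType) (tau : R -> R) :
  quadruple_transformation tau ->
  quadruple_constants tau (quadruple_constant tau) /\
  lbound (quadruple_constants tau) (quadruple_constant tau).
Proof.
move=> [_ A0]; rewrite /quadruple_constant; set A := quadruple_constants tau.
have lA : has_lbound A by exists 0 => L [].
have infA : lbound A (inf A) by move=> L AL; exact: ge_inf.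
split=> //; split=> [|Q y z q p u h].
  by apply: lb_le_inf => // L [].
rewrite -mulrA; set c := mdist q p * _; set l := (X in X <= _).
have lc L : A L -> l <= L * c by move=> [_ /(_ Q y z q p u h)]; rewrite -mulrA.
have [c0|c0] := ltP 0 c.
  rewrite -ler_pdivrMr//; apply: lb_le_inf => // L AL.
  by rewrite ler_pdivrMr// lc.
have [L AL] := A0.
by apply: (le_trans (lc _ AL)); rewrite ler_wnM2r// infA.
Qed.

(* Main.v *)
Require Import Defs.
From HB Require Import structures.
From mathcomp Require Import all_boot all_order all_algebra.
From mathcomp Require Import all_classical all_reals all_analysis.
From mathcomp Require Import ring lra.
Import Order.TTheory GRing.Theory Num.Theory.
Import numFieldNormedType.Exports.
Local Open Scope classical_set_scope.
Local Open Scope ring_scope.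

(** The real line already forces the bound.  For four points of the line the
    combination of squared distances in the premise equals
    [2 (p - q) (y - z) <= 2 |q - p| |y - z|], so the premise always holds and
    the conclusion is available for all distinct [y], [z], [q], [p].  Dividing
    it by [|q - p|] and letting [q] tend to [p] from both sides turns it into a
    bound on a derivative ([line_derive1_le]):
    [|s(p - y) f |p - y| - s(p - z) f |p - z|| <= L f |y - z|], where [f] is
    the derivative of [tau] and [s] the sign.  Two placements of [y], [z], [p]
    compare [f x] with [f (2 x)] in opposite directions:
    - [p] is the midpoint of [y] and [z]: [2 |f x| <= L f (2 x)];
    - [y] is the midpoint of [z] and [p]: [|f x - f (2 x)| <= L f x].

    If [f x <> 0], the first bound gives [L > 0], so the second gives
    [f x > 0] and [f (2 x) <= (1 + L) f x].  Inserted in the first, this yields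
    [2 <= L (1 + L)], that is [1 <= L].  A point with [f x <> 0] exists because
    [tau] is not constant. *)

(** A one-sided growth bound on both sides of [p] controls the size of the
    derivative: the right limit of the difference quotient gives [a <= K], the
    left limit gives [- K <= a]. *)
Lemma norm_derive_le_near (R : realType) (G : R -> R) (p a K : R) :
  is_derive p 1 G a ->
  (\forall q \near p^', G q - G p <= K * `|q - p|) -> `|a| <= K.
Proof.
move=> /is_derive1_caratheodory[g [Gg cg ga]] GK.
have {}GK : \forall q \near p, q != p -> g q * (q - p) <= K * `|q - p|.
  move: GK; rewrite near_withinE; apply: filterS => q + qp => /(_ qp).
  by rewrite Gg.
rewrite ler_norml; apply/andP; split.
- apply: (@cvgr_to_ge _ p^'- _ _ g a).
    by rewrite -ga; apply: cvg_at_left_filter.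
  near=> q.
  have qp : q < p by near: q; exact: nbhs_left_lt.
  have : g q * (q - p) <= K * `|q - p|.
    have : q != p by rewrite lt_eqF.
    by near: q; apply: cvg_within.
  by rewrite ltr0_norm ?subr_lt0// mulrN -mulNr ler_nM2r ?subr_lt0.
- apply: (@cvgr_to_le _ p^'+ _ _ g a).
    by rewrite -ga; apply: cvg_at_right_filter.
  near=> q.
  have qp : p < q by near: q; exact: nbhs_right_gt.
  have : g q * (q - p) <= K * `|q - p|.
    have : q != p by rewrite gt_eqF.
    by near: q; apply: cvg_within.
  by rewrite gtr0_norm ?subr_gt0// ler_pM2r ?subr_gt0.
Unshelve. all: by end_near. Qed.

Lemma is_derive_norm (R : realType) (u : R) :
  u != 0 -> is_derive u 1 (fun t : R => `|t|) (Num.sg u).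
Proof.
rewrite neq_lt => /orP[u0|u0].
- rewrite ltr0_sg//; apply: (@near_eq_is_derive _ _ _ -%R).
    by near=> t; rewrite ltr0_norm//; near: t; exact: lt_nbhsl.
- rewrite gtr0_sg//; apply: (@near_eq_is_derive _ _ _ id).
    by near=> t; rewrite gtr0_norm//; near: t; exact: lt_nbhsr.
Unshelve. all: by end_near. Qed.

Lemma is_derive_comp_dist (R : realType) (tau : R -> R) (y p : R) :
  p != y -> derivable tau `|p - y| 1 ->
  is_derive p 1 (fun t : R => tau `|t - y|)
    ((tau^`()%classic) `|p - y| * Num.sg (p - y)).
Proof.
move=> py dtau.
apply: (@is_derive1_comp _ tau (fun t : R => `|t - y|)).
  by rewrite derive1E; exact: derivableP.
rewrite -[Num.sg _]mulr1.
apply: (@is_derive1_comp _ (fun t : R => `|t|) (fun t : R => t - y)).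
  by apply: is_derive_norm; rewrite subr_eq0.
exact: is_derive_shift.
Qed.

Lemma line_quadruple_le (R : realType) (tau : R -> R) (L y z q p : R) :
  quadruple_constants tau L -> uniq [:: y; z; q; p] ->
  tau `|q - y| - tau `|p - y| - tau `|q - z| + tau `|p - z|
    <= L * `|p - q| * (tau^`()%classic) `|z - y|.
Proof.
move=> [_ /(_ R^o y z q p) H] u; apply: (H u).
change (`|q - y| ^+ 2 - `|p - y| ^+ 2 - `|q - z| ^+ 2 + `|p - z| ^+ 2
  <= 2 * `|p - q| * `|z - y|).
rewrite !real_normK ?num_real// -mulrA -normrM.
have := ler_norm ((p - q) * (y - z)); rewrite !normrM (distrC y z).
lra.
Qed.

(** The increment of [t |-> tau |t - y| - tau |t - z|] from [p] to [q] is the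
    left side of [line_quadruple_le], so that lemma bounds the derivative of
    this function at [p]. *)
Lemma line_derive1_le (R : realType) (tau : R -> R) (L y z p : R) :
  (forall x : R, 0 < x -> derivable tau x 1) -> quadruple_constants tau L ->
  uniq [:: y; z; p] ->
  `|(tau^`()%classic) `|p - y| * Num.sg (p - y)
    - (tau^`()%classic) `|p - z| * Num.sg (p - z)|
  <= L * (tau^`()%classic) `|z - y|.
Proof.
move=> dtau QL; rewrite /= !inE negb_or andbT => /andP[/andP[yz yp] zp].
apply: (@norm_derive_le_near _ (fun t => tau `|t - y| - tau `|t - z|) p).
  apply: is_deriveB; apply: is_derive_comp_dist; rewrite 1?eq_sym//;
    by apply: dtau; rewrite normr_gt0 subr_eq0 eq_sym.
have neq_near (w : R) : w != p -> \forall q \near p, q != w.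
  by move=> wp; apply: open_nbhs_nbhs; split; [exact: open_neq|rewrite /= eq_sym].
near=> q.
have qp : q != p by near: q; exact: nbhs_dnbhs_neq.
have qy : q != y by near: q; exact/nbhs_dnbhs/neq_near.
have qz : q != z by near: q; exact/nbhs_dnbhs/neq_near.
have := @line_quadruple_le _ tau L y z q p QL.
rewrite /= !inE !negb_or yz yp zp qp !(eq_sym _ q) qy qz => /(_ isT).
rewrite (distrC p q); lra.
Unshelve. all: by end_near. Qed.

Lemma derive1_eq0_constant (R : realType) (tau : R -> R) :
  (forall x : R, 0 < x -> derivable tau x 1) ->
  (forall x : R, 0 < x -> (tau^`()%classic) x = 0) ->
  forall x y : R, 0 < x -> 0 < y -> tau x = tau y.
Proof.
move=> dtau tau0 x y; wlog xy : x y / x <= y => [H x0 y0|x0 y0].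
  by have [/H|/ltW/H] := leP x y; [apply|move=> ->].
have pos t : t \in `[x, y]%R -> 0 < t.
  by rewrite in_itv/= => /andP[/(lt_le_trans x0)].
have [t /subset_itv_oo_cc/pos t0|| c /pos c0] :=
    @MVT_segment _ tau (tau^`()%classic) x y xy.
- by rewrite derive1E; apply: derivableP; exact: dtau.
- by apply: derivable_within_continuous => t /pos; exact: dtau.
- by rewrite tau0// mul0r => /eqP; rewrite subr_eq0 => /eqP ->.
Qed.

Theorem proposition10 (R : realType) (tau : R -> R)
  (htau : quadruple_transformation tau)
  (hnc : ~ exists c : R, forall x : R, 0 < x -> tau x = c) :
  1 <= quadruple_constant tau.
Proof.
have [dtau _] := htau; have [QL _] := quadruple_constant_smallest htau.
set L := quadruple_constant tau in QL *; have [L0 _] := QL.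
set f := tau^`()%classic.
have [x x0 fx0] : exists2 x : R, 0 < x & f x != 0.
  apply: contrapT => nex; apply: hnc; exists (tau 1) => x x0.
  apply: derive1_eq0_constant => // t t0.
  by apply: contrapT => /eqP ft; apply: nex; exists t.
have x20 : 0 < 2 * x by rewrite mulr_gt0.
have double : 2 * `|f x| <= L * f (2 * x).
  have := @line_derive1_le _ tau L 0 (2 * x) x dtau QL.
  rewrite /= !inE negb_or andbT !(eq_sym 0) (gt_eqF x20) (gt_eqF x0) gt_eqF; last by lra.
  move=> /(_ isT).
  have -> : x - 2 * x = - x by ring.
  rewrite !subr0 normrN sgrN (gtr0_norm x0) (gtr0_norm x20) (gtr0_sg x0) -/f.
  have -> : f x * 1 - f x * - 1 = 2 * f x by ring.
  by rewrite normrM (@ger0_norm _ 2).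
have half : `|f x - f (2 * x)| <= L * f x.
  have := @line_derive1_le _ tau L 0 (- x) x dtau QL.
  rewrite /= !inE negb_or andbT !(eq_sym 0) oppr_eq0 (gt_eqF x0) lt_eqF; last by lra.
  move=> /(_ isT).
  have -> : x - - x = 2 * x by ring.
  rewrite !subr0 normrN (gtr0_norm x0) (gtr0_norm x20) (gtr0_sg x0) (gtr0_sg x20).
  by rewrite -/f !mulr1.
(* If [f x < 0], then [half] makes [f (2 * x)] negative, against [double]. *)
have fx_gt0 : 0 < f x.
  rewrite lt_neqAle eq_sym fx0/= leNgt; apply/negP => fx_lt0.
  have nfx : 0 < `|f x| by rewrite normr_gt0.
  have := ler_norm (f (2 * x) - f x); rewrite distrC => hn.
  nra.
have f2x : f (2 * x) <= (1 + L) * f x.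
  have := ler_norm (f (2 * x) - f x); rewrite distrC; lra.
move: double; rewrite gtr0_norm// => double.
have : 2 * f x <= L * ((1 + L) * f x).
  by apply: le_trans double _; exact: ler_wpM2l.
rewrite mulrA ler_pM2r//; nra.
Qed.
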